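(* If $k$ is a finite field of characteristic $p>2$, then $k[x]_0$ has infinitely many maximal $T$-spaces.
   Context: $k[x]_0=xk[x]$ denotes the free (nonunitary) associative $k$-algebra on one generator $x$. A $T$-space of an associative $k$-algebra $A$ is a $k$-linear subspace of $A$ invariant under every $k$-algebra endomorphism of $A$. A maximal $T$-space is a maximal element, under inclusion, among the proper $T$-spaces. *)

(* Defs.v *)
From HB Require Import structures.
From mathcomp Require Import all_boot all_order all_algebra.
From mathcomp Require Import boolp classical_sets functions cardinality.

Set Implicit Arguments.
Unset Strict Implicit.
Unset Printing Implicit Defensive.

Import GRing.Theory.
Local Open Scope ring_scope.
Local Open Scope classical_set_scope.

(* Associative algebras without a required identity element; in particular
   [numul] has to be distinct from the ring product [*%R], which comes with
   a [1]. *)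
HB.mixin Record Lmodule_isNUAlgebra (k : fieldType) A of GRing.Lmodule k A := {
  numul : A -> A -> A;
  numulA : associative numul;
  numulDl : left_distributive numul +%R;
  numulDr : right_distributive numul +%R;
  numulZl : forall (c : k) (u v : A), numul (c *: u) v = c *: numul u v;
  numulZr : forall (c : k) (u v : A), numul u (c *: v) = c *: numul u v
}.

#[short(type="nuAlgType")]
HB.structure Definition NUAlgebra (k : fieldType) :=
  {A of GRing.Lmodule k A & Lmodule_isNUAlgebra k A}.

Section TSpaces.
Variables (k : fieldType) (A : nuAlgType k).

Definition nualg_endo (f : A -> A) : Prop :=
  linear f /\ {morph f : u v / numul u v}.

Definition subspace (V : set A) : Prop :=
  V 0 /\ forall (c : k) (u v : A), V u -> V v -> V (c *: u + v).

Definition Tspace (V : set A) : Prop :=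
  subspace V /\ forall f : A -> A, nualg_endo f -> f @` V `<=` V.

Definition proper_Tspace (V : set A) : Prop := Tspace V /\ V <> setT.

Definition maximal_Tspace (V : set A) : Prop :=
  proper_Tspace V /\ forall W : set A, proper_Tspace W -> V `<=` W -> W = V.

End TSpaces.

Section XPoly.
Variable k : fieldType.

(* [xpoly k] is the ideal x k[x] of k[x], as an algebra without identity: its
   endomorphisms are the substitutions x |-> q with q in x k[x]. *)
Definition xideal : {pred {poly k}} := fun p => 'X %| p.

Record xpoly := XPoly { xpoly_val : {poly k}; _ : xpoly_val \in xideal }.

HB.instance Definition _ := [isSub for xpoly_val].
HB.instance Definition _ := [Choice of xpoly by <:].

Fact xideal_submod_closed : subsemimod_closed xideal.
Proof.
split; first split.
- exact: dvdp0.
- by move=> p q; apply: dvdp_add.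
- by move=> c p Xp; rewrite unfold_in -mul_polyC dvdp_mull.
Qed.

HB.instance Definition _ :=
  GRing.SubChoice_isSubLmodule.Build k {poly k} xideal xpoly
    xideal_submod_closed.

Fact xpoly_mul_subproof (u v : xpoly) : val u * val v \in xideal.
Proof. by rewrite unfold_in dvdp_mulr //; apply: (valP u). Qed.

Definition xpoly_mul (u v : xpoly) : xpoly := XPoly (xpoly_mul_subproof u v).

Fact xpoly_mulA : associative xpoly_mul.
Proof. by move=> u v w; apply: val_inj; rewrite /= mulrA. Qed.

Fact xpoly_mulDl : left_distributive xpoly_mul +%R.
Proof. by move=> u v w; apply: val_inj; rewrite /= mulrDl. Qed.

Fact xpoly_mulDr : right_distributive xpoly_mul +%R.
Proof. by move=> u v w; apply: val_inj; rewrite /= mulrDr. Qed.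

Fact xpoly_mulZl (c : k) (u v : xpoly) :
  xpoly_mul (c *: u) v = c *: xpoly_mul u v.
Proof. by apply: val_inj; rewrite /= scalerAl. Qed.

Fact xpoly_mulZr (c : k) (u v : xpoly) :
  xpoly_mul u (c *: v) = c *: xpoly_mul u v.
Proof. by apply: val_inj; rewrite /= scalerAr. Qed.

HB.instance Definition _ := Lmodule_isNUAlgebra.Build k xpoly
  xpoly_mulA xpoly_mulDl xpoly_mulDr xpoly_mulZl xpoly_mulZr.

End XPoly.

(* Main.v *)
Require Import Defs.
From mathcomp Require Import all_boot all_order all_algebra.
From mathcomp Require Import all_solvable all_field.
From mathcomp Require Import boolp classical_sets functions cardinality.

(** Write q for the cardinality of k and K_n for the field with q^n elements.
The polynomials f with f(0) = 0 whose values f(a), for a in K_n, all have trace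
zero over k form a T-space V_n ([traceless n]): the trace is k-linear, and
f(u(a)) is again a value of f on K_n.  V_n is proper for n > 0, because the
trace is not identically zero on K_n and hence x is not in V_n.

Infinitely many of these T-spaces are pairwise comaximal.  Let n > 0 and let m
be a multiple of n with m/n divisible by p.  Take f inducing the identity on
K_n and zero on the rest of K_m.  Then x - f vanishes on K_n, so it lies in V_n;
and f lies in V_m, because the trace of a in K_n from K_m down to k is m/n times
its trace from K_n, that is, zero.  A T-space containing both V_n and V_m thus
contains x = (x - f) + f, and x generates k[x]_0 as a T-space
([traceless_comaximal], [Tspace_xgen]).

Since k[x]_0 is generated as a T-space by the single element x, Zorn's lemma
puts every proper T-space inside a maximal one ([proper_sub_maximal_Tspace]).
Maximal T-spaces M_i containing V_(p^i) are pairwise distinct by comaximality.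

The extensions K_n need not be constructed: vanishing on K_n is divisibility by
X^(q^n) - X, and the trace of f is the sum of the f^(q^i), i < n.  With this
translation, the stability of K_n under polynomials with coefficients in k
becomes [dvdp_FrobeniusB]. *)

Set Implicit Arguments.
Unset Strict Implicit.
Unset Printing Implicit Defensive.

Import GRing.Theory.
Local Open Scope ring_scope.
Local Open Scope classical_set_scope.

(** * Maximal T-spaces of singly generated algebras *)

Section GeneratedTSpace.
Variables (k : fieldType) (A : nuAlgType k).
Implicit Types V W : set A.

Lemma subspaceD V (u v : A) : subspace V -> V u -> V v -> V (u + v).
Proof. by case=> _ VD Vu Vv; rewrite -[u]scale1r; apply: VD. Qed.

(** Joining V to each member of the chain makes the empty chain harmless: its
union is then V instead of the empty set, which is not a subspace. *)
Lemma chain_Tspace V (F : set (set A)) :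
  Tspace V -> F `<=` (fun W => Tspace (W `|` V)) ->
  total_on F subset -> Tspace ((\bigcup_(W in F) W) `|` V).
Proof.
move=> TV TF totF.
have in1 u : ((\bigcup_(W in F) W) `|` V) u ->
    V u \/ exists2 W, F W & W u.
  by case=> [[W FW Wu]|]; [right; exists W | left].
have out W u : F W -> (W `|` V) u -> ((\bigcup_(W in F) W) `|` V) u.
  by move=> FW [Wu|Vu]; [left; exists W | right].
split; last first.
  move=> f endo_f _ [u /in1 [Vu|[W FW Wu]] <-].
    by right; apply: (TV.2 f endo_f); exists u.
  by apply: out (FW) _; apply: ((TF _ FW).2 f endo_f); exists u => //; left.
split; first by right; apply: TV.1.1.
move=> c u v /in1 [Vu|[W FW Wu]] /in1 [Vv|[W' FW' Wv]].
- by right; apply: TV.1.2.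
- by apply: out (FW') _; apply: (TF _ FW').1.2; [right | left].
- by apply: out (FW) _; apply: (TF _ FW).1.2; [left | right].
- case: (totF _ _ FW FW') => sub.
    by apply: out (FW') _; apply: (TF _ FW').1.2; left => //; apply: sub.
  by apply: out (FW) _; apply: (TF _ FW).1.2; left => //; apply: sub.
Qed.

(** Being proper means missing the generator g, a condition that passes to the
union of a chain; so Zorn's lemma applies. *)
Lemma proper_sub_maximal_Tspace (g : A) V :
    (forall W, Tspace W -> W g -> W = setT) -> proper_Tspace V ->
  exists2 M, maximal_Tspace M & V `<=` M.
Proof.
move=> gen_g [TV pV].
have proper W : Tspace W -> W <> setT <-> ~ W g.
  move=> TW; split; first by apply: contra_not; apply: gen_g.
  by apply: contra_not => ->.
have [|M [[TM M'g] maxM]] :=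
    @Zorn_bigcup A (fun W => Tspace (W `|` V) /\ ~ (W `|` V) g).
  move=> F PF totF; split.
    by apply: chain_Tspace => // W /PF[].
  case=> [[W FW Wg]|]; first by case: (PF _ FW) => _; apply; left.
  exact/(proper V TV).
exists (M `|` V); last by move=> u Vu; right.
split; first by split=> //; apply/(proper _ TM).
move=> W [TW /(proper _ TW) W'g] MVW; apply: contrapT => neqW.
have WV : W `|` V = W by apply/setUidPl => u Vu; apply: MVW; right.
apply: (maxM W); last by rewrite WV.
split=> [u Mu|WM]; first by apply: MVW; left.
by apply: neqW; apply/seteqP; split=> // u /WM; left.
Qed.

End GeneratedTSpace.

(** * Substitutions *)

Section Substitution.
Variable k : fieldType.
Local Notation A := (xpoly k).

Fact xgen_subproof : ('X : {poly k}) \in @xideal k.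
Proof. exact: dvdpp. Qed.

Definition xgen : A := XPoly xgen_subproof.

(** The algebra has no constants, so the induction is on the cofactor r of X in u
and uses (r X + c) X = (r X) X + c X, both of whose terms are built inside the
algebra from r X and X. *)
Lemma endo_comp_poly (f : A -> A) : nualg_endo f ->
  forall u : A, val (f u) = val u \Po val (f xgen).
Proof.
move=> [lin_f mul_f] u.
have f0 : f 0 = 0.
  by have := lin_f (-1) 0 0; rewrite scaler0 addr0 scaleN1r addNr.
have fD v w : f (v + w) = f v + f w.
  by have := lin_f 1 v w; rewrite !scale1r.
have fZ c v : f (c *: v) = c *: f v.
  by have := lin_f c v 0; rewrite !addr0 f0 addr0.
suff xf (r : {poly k}) (v : A) :
    val v = r * 'X -> val (f v) = val v \Po val (f xgen).
  by have /dvdpP[r] := valP u; apply: xf.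
elim/poly_ind: r v => [|r c IHr] v def_v.
  have -> : v = 0 by apply: val_inj; rewrite def_v mul0r.
  by rewrite f0 comp_poly0.
have rX : r * 'X \in @xideal k by rewrite unfold_in dvdp_mull.
have -> : v = numul (XPoly rX) xgen + c *: xgen.
  by apply: val_inj; rewrite def_v /= mulrDl mul_polyC.
rewrite fD mul_f fZ /= (IHr (XPoly rX)) //=.
by rewrite comp_polyD !comp_polyM comp_polyX comp_polyZ comp_polyX.
Qed.

Lemma subst_endo (u : A) : exists2 f : A -> A, nualg_endo f & f xgen = u.
Proof.
have uX (v : A) : val v \Po val u \in @xideal k.
  have /dvdpP[r ->] := valP v; rewrite unfold_in comp_polyM comp_polyX.
  exact: dvdp_mull (valP u).
exists (fun v => XPoly (uX v)); last by apply: val_inj; rewrite /= comp_polyX.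
split=> [c v w|v w]; apply: val_inj => /=.
  by rewrite comp_polyD comp_polyZ.
by rewrite comp_polyM.
Qed.

Lemma Tspace_xgen (W : set A) : Tspace W -> W xgen -> W = setT.
Proof.
move=> [_ TW] Wx; apply/seteqP; split=> // u _.
by have [f /TW fW <-] := subst_endo u; apply: fW; exists xgen.
Qed.

(** The identity a^i - b^i = (a - b)(...) extended to linear combinations of
powers. *)
Lemma dvdp_comp_polyB (f a b : {poly k}) : (a - b) %| ((f \Po a) - (f \Po b)).
Proof.
elim/poly_ind: f => [|f c IHf]; first by rewrite !comp_poly0 subrr dvdp0.
rewrite !comp_polyD !comp_polyM !comp_polyX !comp_polyC.
rewrite opprD addrACA subrr addr0.
have -> : (f \Po a) * a - (f \Po b) * b =
    ((f \Po a) - (f \Po b)) * a + (f \Po b) * (a - b).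
  by rewrite mulrBl mulrBr addrA subrK.
exact: dvdp_add (dvdp_mulr _ IHf) (dvdp_mull _ (dvdpp _)).
Qed.

End Substitution.

(** * Polynomials whose values have trace zero *)

Section TraceZero.
Variables (k : finFieldType) (p : nat).
Hypothesis charkp : p \in [pchar k].
Local Notation q := #|k|.
Local Notation A := (xpoly k).
Implicit Types f g u G : {poly k}.

Lemma card_pnat n : [pchar {poly k}].-nat (q ^ n)%N.
Proof.
have : p.-nat q.
  by rewrite -cardsT; exact: (abelem_pgroup (fin_ring_pchar_abelem charkp)).
rewrite pnatX => /(sub_in_pnat _) -> // r _ /eqP ->.
by rewrite pchar_poly.
Qed.

(** Raising to the power q^n is additive and fixes the coefficients, which are
elements of the field with q elements. *)
Lemma Frobenius_comp n f : f ^+ (q ^ n) = f \Po 'X^(q ^ n).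
Proof.
elim/poly_ind: f => [|f c IHf].
  by rewrite comp_poly0 expr0n expn_eq0 -leqn0 leqNgt (ltnW (finNzRing_gt1 _)).
rewrite exprDn_pchar ?card_pnat // exprMn IHf comp_polyD comp_polyM.
rewrite comp_polyX comp_polyC -rmorphXn; congr (_ + _%:P).
by elim: n {IHf} => // n IHn; rewrite expnS exprM expf_card.
Qed.

(** A polynomial with coefficients in k maps the roots of X^(q^n) - X, that is
the elements of K_n, to roots of the same polynomial. *)
Lemma dvdp_FrobeniusB n f : ('X^(q ^ n) - 'X) %| (f ^+ (q ^ n) - f).
Proof.
by have := dvdp_comp_polyB f 'X^(q ^ n) 'X; rewrite comp_polyXr -Frobenius_comp.
Qed.

(** When f is evaluated at an element a of the field with q^n elements, this is
the trace of f(a) over k. *)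
Definition trace n f : {poly k} := \sum_(i < n) f ^+ (q ^ i).

Lemma traceD n f g : trace n (f + g) = trace n f + trace n g.
Proof.
by rewrite -big_split; apply: eq_bigr => i _; rewrite exprDn_pchar ?card_pnat.
Qed.

Lemma traceZ n c f : trace n (c *: f) = c *: trace n f.
Proof.
rewrite scaler_sumr; apply: eq_bigr => i _.
by rewrite Frobenius_comp comp_polyZ -Frobenius_comp.
Qed.

Lemma trace_comp n f u : trace n (f \Po u) = trace n f \Po u.
Proof. by rewrite rmorph_sum; apply: eq_bigr => i _; rewrite rmorphXn. Qed.

Lemma dvdp_trace n G f : G %| f -> G %| trace n f.
Proof.
move=> Gf; apply: (big_ind (fun g => G %| g)) => [|g g0|i _].
- exact: dvdp0.
- exact: dvdp_add.
- by rewrite dvdp_exp ?expn_gt0 ?(ltnW (finNzRing_gt1 _)).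
Qed.

(** Transitivity of the trace: modulo G the hypothesis says that f is fixed by
the n-th power of Frobenius, and each of the s blocks of n consecutive terms of
the longer trace then sums to the shorter one. *)
Lemma dvdp_traceM n s G f : G %| (f ^+ (q ^ n) - f) ->
  G %| (trace (n * s) f - trace n f *+ s).
Proof.
move=> Gf; elim: s => [|s IHs].
  by rewrite muln0 /trace big_ord0 subrr dvdp0.
have -> : trace (n * s.+1) f = trace n f + trace (n * s) (f ^+ (q ^ n)).
  rewrite /trace mulnS big_split_ord /=; congr (_ + _).
  by apply: eq_bigr => i _; rewrite expnD exprM.
have -> : trace (n * s) (f ^+ (q ^ n)) =
    trace (n * s) (f ^+ (q ^ n) - f) + trace (n * s) f.
  by rewrite -traceD subrK.
rewrite mulrS opprD addrACA subrr add0r -addrA dvdp_add //; exact: dvdp_trace.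
Qed.

Definition traceless n : set A :=
  [set f : A | ('X^(q ^ n) - 'X) %| trace n (val f)].

Lemma Tspace_traceless n : Tspace (traceless n).
Proof.
split; first split=> [|c u v Tu Tv].
- by rewrite /traceless /= dvdp_trace ?dvdp0.
- rewrite /traceless /= traceD traceZ dvdp_add // -mul_polyC.
  exact: dvdp_mull.
move=> f /endo_comp_poly subst_f _ [u Tu <-].
rewrite /traceless /= subst_f trace_comp.
apply: dvdp_trans (dvdp_comp_poly _ Tu).
by rewrite comp_polyB comp_polyX rmorphXn /= comp_polyX dvdp_FrobeniusB.
Qed.

(** The trace of X has degree q^(n-1) and is nonzero, so it is not divisible by
a polynomial of degree q^n. *)
Lemma traceless_xgen n : (0 < n)%N -> ~ traceless n (xgen k).
Proof.
case: n => // n _; rewrite /traceless /=.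
have q_gt1 : (1 < q)%N := finNzRing_gt1 k.
have q_gt0 := ltnW q_gt1.
have sz_G : size ('X^(q ^ n.+1) - 'X : {poly k}) = (q ^ n.+1).+1.
  rewrite size_polyDl size_polyXn // size_polyN size_polyX.
  by rewrite ltnS (leq_ltn_trans _ (ltn_expl n.+1 q_gt1)).
have tr1 : (trace n.+1 'X)`_1 = 1 :> k.
  rewrite coef_sum big_ord_recl coefXn expn0 eqxx big1 ?addr0 // => i _.
  by rewrite coefXn -[1%N](expn0 q) eqn_exp2l.
move/dvdp_leq; rewrite sz_G => /(_ _)/wrap[|].
  by apply: contra_eq_neq tr1 => ->; rewrite coef0 eq_sym oner_eq0.
apply/negP; rewrite -leqNgt; apply: leq_trans (size_sum _ _ _) _.
apply/bigmax_leqP => i _; rewrite size_polyXn.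
by rewrite ltn_exp2l.
Qed.

(** The witness is f = X e with e = 1 - (X^(q^n) - X)^(q^(n s) - 1).  On the
field with q^(n s) elements, e is the indicator function of its subfield with
q^n elements, since a nonzero element has (q^(n s) - 1)-th power 1.  Hence f is the
identity on the subfield and zero elsewhere, and always takes values in the
subfield; the trace of these values is multiplied by s = 0. *)
Lemma traceless_comaximal n s : (0 < n)%N -> (p %| s)%N -> (0 < s)%N ->
  exists2 f : A, traceless (n * s) f & traceless n (xgen k - f).
Proof.
move=> n_gt0 p_s s_gt0.
have q_gt1 : (1 < q)%N := finNzRing_gt1 k.
set Q := (q ^ n)%N; set M := (q ^ (n * s))%N.
pose h : {poly k} := 'X^Q - 'X; pose e : {poly k} := 1 - h ^+ M.-1.
have M_gt1 : (1 < M)%N.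
  by rewrite (leq_ltn_trans _ (ltn_expl (n * s) q_gt1)) // muln_gt0 n_gt0.
have h_hM : h %| h ^+ M.-1 by rewrite dvdp_exp // -ltnS prednK // ltnW.
(* Each element of the larger field is a zero of h, if it lies in the smaller
   one, or else of e. *)
have G_he : ('X^M - 'X) %| (h * e).
  rewrite mulrBr mulr1 -exprS prednK ?(ltnW M_gt1) // -[h - _]opprB dvdpNr.
  exact: dvdp_FrobeniusB.
(* Modulo h e, the polynomial e is idempotent. *)
have he_e : (h * e) %| (e ^+ Q - e).
  rewrite -(@prednK Q) ?expn_gt0 ?(ltnW q_gt1) // exprSr -{4}[e]mul1r -mulrBl.
  rewrite dvdp_mul // subrX1 dvdp_mulr //.
  by rewrite /e addrAC subrr add0r dvdpNr.
have Xe : 'X * e \in @xideal k by rewrite unfold_in dvdp_mulr.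
exists (XPoly Xe); rewrite /traceless /=; last first.
  by rewrite dvdp_trace // mulrBr mulr1 subKr dvdp_mull.
have/(@dvdp_traceM n s) : ('X^M - 'X) %| (('X * e) ^+ Q - 'X * e).
  apply: dvdp_trans G_he _.
  have -> : ('X * e) ^+ Q - 'X * e = 'X^Q * (e ^+ Q - e) + h * e.
    by rewrite exprMn ['X^Q * _]mulrBr [h * e]mulrBl addrA subrK.
  by rewrite dvdp_add // dvdp_mull.
have charP : p \in [pchar {poly k}] by rewrite pchar_poly.
have s0 : s%:R = 0 :> {poly k} by apply/eqP; rewrite -(dvdn_pcharf charP).
by rewrite -[_ *+ s]mulr_natr s0 mulr0 subr0.
Qed.

End TraceZero.

Theorem corollary3p2 (k : finFieldType) (p : nat)
    (charkp : p \in [pchar k]) (p_gt2 : (2 < p)%N) :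
  infinite_set [set V : set (xpoly k) | maximal_Tspace V].
Proof.
have p_gt0 := ltnW (ltnW p_gt2).
have max_over i : exists M : set (xpoly k),
    maximal_Tspace M /\ @traceless k (p ^ i) `<=` M.
  have proper_i : proper_Tspace (@traceless k (p ^ i)).
    split; first exact: (Tspace_traceless charkp).
    move=> VT; have := @traceless_xgen k (p ^ i); rewrite expn_gt0 p_gt0 VT.
    by move/(_ isT); apply.
  by have [M] := proper_sub_maximal_Tspace (@Tspace_xgen k) proper_i; exists M.
have [M maxM] := choice max_over.
have neqM i j : (i < j)%N -> M i <> M j.
  move=> ltij eqM.
  have [f Tjf Tif] : exists2 f : xpoly k, @traceless k (p ^ j) f
      & @traceless k (p ^ i) (xgen k - f).
    rewrite -(subnKC (ltnW ltij)) expnD.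
    apply: (traceless_comaximal charkp) => //; rewrite ?expn_gt0 ?p_gt0 //.
    by rewrite dvdn_exp // subn_gt0.
  have [[[TM pM] _] sub_i] := maxM i.
  apply: pM; apply: Tspace_xgen => //.
  rewrite -(subrK f (xgen k)); apply: subspaceD TM.1 (sub_i _ Tif) _.
  by rewrite eqM; apply: (maxM j).2.
apply/infiniteP/pcard_leP/injfunPex; exists M.
  by move=> i _; exact: (maxM i).1.
move=> i j _ _ eqM; case: (ltngtP i j) => // lt; first by case: (neqM _ _ lt).
by case: (neqM _ _ lt).
Qed.
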